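(* Let $p>2$ be a prime and $\lambda$ any ordering of $\mathbb{F}_p\times\mathbb{F}_p$. The structure of the orbit tree of the Sushchansky group $G_\lambda=\langle A,B_\lambda\rangle$ acting on $X^*$ does not depend on $\lambda$ and is the following: there is exactly one orbit on level $0$ and exactly one orbit on level $1$; there are exactly $p$ orbits on level $2$, all adjacent to the unique orbit of level $1$; one of these $p$ vertices (the orbit of the word $00$) is the beginning of an infinite ray, i.e. it and each of its descendants has exactly one child; and each of the remaining $p-1$ vertices on level $2$ is the root of a regular $p$-ary rooted tree, i.e. it and each of its descendants has exactly $p$ children.
   Context: Tree automorphisms. Let $p>2$ be a prime and $X=\{0,1,\dots,p-1\}$, identified with the field $\mathbb{F}_p$. The set $X^*$ of finite words over $X$ is a rooted $p$-ary tree (root the empty word; $w$ is joined to $wx$; level $n$ is $X^n$). For $g\in\mathrm{Aut}\,X^*$ and $v\in X^*$, the restriction $g|_v\in \mathrm{Aut}\,X^*$ is defined by $g(vw)=g(v)\,g|_v(w)$. Write $g=(g|_0,g|_1,\dots,g|_{p-1})\pi_g$, where $\pi_g$ is the permutation of $X$ induced by $g$ (omitted if trivial). In a product $gh$, $g$ acts first. Let $\sigma=(0,1,\dots,p-1)$ be the cyclic permutation $x\mapsto x+1$ of $X$; $\sigma$ also denotes the automorphism $(1,\dots,1)\sigma$. Sushchansky groups. Let $\lambda=\{(\alpha_i,\beta_i): i=1,\dots,p^2\}$ be an ordering (enumeration without repetition) of all pairs in $\mathbb{F}_p\times\mathbb{F}_p$. Put $u_i=0$, $v_i=1$ if $\beta_i=0$,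 and $u_i=1$, $v_i=-\alpha_i/\beta_i$ if $\beta_i\neq 0$. Define automorphisms $q_i,r_i$ ($i=1,\dots,p^2$, indices taken modulo $p^2$) of $X^*$ recursively by $$q_i=(q_{i+1},\sigma^{u_i},1,\dots,1),\qquad r_i=(r_{i+1},\sigma^{v_i},1,\dots,1).$$ Let $A=(1,\sigma,\sigma^2,\dots,\sigma^{p-1})\sigma$, and let $B_\lambda$ be the automorphism acting trivially on $X^2$ with $B_\lambda|_{00}=q_1$, $B_\lambda|_{10}=r_1$, $B_\lambda|_{21}=\sigma$, and all other restrictions $B_\lambda|_{xy}$, $xy\in X^2$, trivial. The Sushchansky group of type $\lambda$ is $G_\lambda=\langle A,B_\lambda\rangle$. Orbit tree. For a group $G$ acting on $X^*$ by tree automorphisms, the orbit tree of $G$ is the graph whose vertices are the orbits of $G$ on the levels of $X^*$, two orbits being adjacent if and only if they contain vertices that are adjacent in $X^*$. It is rooted at the orbit of the empty word; a child of an orbit on level $n$ is an adjacent orbit on level $n+1$. *)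

(* Defs.v *)
From mathcomp Require Import all_boot all_order all_algebra.
From mathcomp Require Import boolp classical_sets functions cardinality.

Set Implicit Arguments.
Unset Strict Implicit.
Unset Printing Implicit Defensive.

Import GRing.Theory.

Local Open Scope classical_set_scope.
Local Open Scope ring_scope.

Section RootedTree.
Variable X : Type.
Implicit Types (g h : seq X -> seq X) (v w : seq X) (O : set (seq X)).

Definition tree_adj v w : Prop :=
  (exists x, w = rcons v x) \/ (exists x, v = rcons w x).

(* Automorphisms of the rooted tree X^*; fixing the root amounts to preserving
   levels. *)
Definition tree_aut g : Prop :=
  [/\ bijective g, g [::] = [::] &
      forall v w, tree_adj (g v) (g w) <-> tree_adj v w].

(* g|_v, characterised by g(vw) = g(v) g|_v(w). *)
Definition restriction g v : seq X -> seq X := fun w => drop (size v) (g (v ++ w)).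

(* (s 0, ..., s (p-1)) pi : the map xw |-> pi(x) (s x)(w). *)
Definition wreath (s : X -> seq X -> seq X) (pi : X -> X) : seq X -> seq X :=
  fun w => if w is x :: w' then pi x :: s x w' else [::].

(* The subgroup generated by S; in a product gh, g acts first. *)
Inductive generated (S : set (seq X -> seq X)) : set (seq X -> seq X) :=
| gen_in g : S g -> generated S g
| gen_one : generated S id
| gen_mul g h : generated S g -> generated S h -> generated S (h \o g)
| gen_inv g h : generated S g -> cancel g h -> cancel h g -> generated S h.

Lemma restriction_wreath s pi x : restriction (wreath s pi) [:: x] = s x.
Proof. by apply/funext => w; rewrite /restriction /= drop0. Qed.

(* A sufficient condition, together with bijectivity, for being a tree
   automorphism. *)
Definition rcons_compatible g : Prop :=
  g [::] = [::] /\ forall v x, exists y, g (rcons v x) = rcons (g v) y.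

Lemma tree_aut_cancel g h :
  cancel g h -> cancel h g -> rcons_compatible g -> rcons_compatible h ->
  tree_aut g.
Proof.
move=> gK hK [g0 gr] [h0 hr]; split=> //; first by exists h.
have adj k : (forall v x, exists y, k (rcons v x) = rcons (k v) y) ->
    forall v w, tree_adj v w -> tree_adj (k v) (k w).
  move=> kr v w [[x ->]|[x ->]]; [left|right]; exact: kr.
by move=> v w; split=> [/(adj h hr)|/(adj g gr)]; rewrite ?gK.
Qed.

Lemma wreath_compatible s pi :
  (forall x, rcons_compatible (s x)) -> rcons_compatible (wreath s pi).
Proof.
move=> sc; split=> // -[|y v] x /=; first by rewrite (sc x).1; exists (pi x).
by have [z ->] := (sc y).2 v x; exists z.
Qed.

Lemma generated_tree_aut (S : set (seq X -> seq X)) :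
  S `<=` @tree_aut -> generated S `<=` @tree_aut.
Proof.
move=> Saut g; elim=> {g} [g /Saut //||g h _ [gb g0 ga] _ [hb h0 ha]|g h _ [gb g0 ga] gK hK].
- by split=> //; exists id.
- split=> [||v w] /=; [exact: bij_comp|by rewrite g0 h0|by rewrite ha ga].
- split=> [||v w]; [by exists g|by rewrite -g0 gK|].
  by rewrite -ga !hK.
Qed.

Variable G : set (seq X -> seq X).

Definition tree_orbit w : set (seq X) := [set g w | g in G].

Definition level_orbits (n : nat) : set (set (seq X)) :=
  [set tree_orbit w | w in [set w | size w = n]].

Definition orbit_vertices : set (set (seq X)) :=
  [set O | exists n, level_orbits n O].

Definition orbit_adj O O' : Prop :=
  exists v w, [/\ O v, O' w & tree_adj v w].

Definition children O : set (set (seq X)) :=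
  [set O' | exists n,
     [/\ level_orbits n O, level_orbits n.+1 O' & orbit_adj O O']].

(* Reflexive: every orbit is a descendant of itself. *)
Inductive descendant O : set (set (seq X)) :=
| desc_refl : descendant O O
| desc_child O' O'' : descendant O O' -> children O' O'' -> descendant O O''.

End RootedTree.

(* Isomorphism of the orbit trees of G and H as rooted graphs. *)
Definition orbit_tree_iso (X : Type) (G H : set (seq X -> seq X)) : Prop :=
  exists f : set (seq X) -> set (seq X),
    [/\ set_bij (orbit_vertices G) (orbit_vertices H) f,
        f (tree_orbit G [::]) = tree_orbit H [::] &
        forall O O', orbit_vertices G O -> orbit_vertices G O' ->
          (orbit_adj (f O) (f O') <-> orbit_adj O O')].

Section Sushchansky.
Variable p : nat.
Notation word := (seq 'F_p).

Definition sigma : word -> word := wreath (fun=> id) (fun x => x + 1).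

(* sigma has order p, so its powers are indexed by F_p. *)
Definition sigma_pow (k : 'F_p) : word -> word := iter (k : nat) sigma.

Lemma sigma_powE k x w : sigma_pow k (x :: w) = x + k :: w.
Proof.
rewrite -{2}(natr_Zp k) /sigma_pow; elim: (k : nat) => [|n /= ->].
  by rewrite addr0.
by rewrite /= -addrA -natr1.
Qed.

Lemma sigma_pow0 k : sigma_pow k [::] = [::].
Proof. by rewrite /sigma_pow; elim: (k : nat) => //= n ->. Qed.

Lemma sigma_powK k : cancel (sigma_pow k) (sigma_pow (- k)).
Proof. by case=> [|x w]; rewrite ?sigma_pow0 // !sigma_powE addrK. Qed.

Lemma sigma_pow_compatible k : rcons_compatible (sigma_pow k).
Proof.
split=> [|[|y v] x]; first exact: sigma_pow0.
  by exists (x + k); rewrite sigma_powE sigma_pow0.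
by exists x; rewrite /= !sigma_powE.
Qed.

Lemma sigma1 : sigma = sigma_pow 1.
Proof. by apply/funext => -[|x w]; rewrite ?sigma_pow0 ?sigma_powE. Qed.

(* The indices 1, ..., p^2 are taken modulo p^2, i.e. in 'Z_(p^2), with p^2
   represented by 0. *)
Variable lam : 'Z_(p ^ 2) -> 'F_p * 'F_p.

Definition ordering : Prop := bijective lam.

Definition sus_u (i : 'Z_(p ^ 2)) : 'F_p :=
  if (lam i).2 == 0 then 0 else 1.

Definition sus_v (i : 'Z_(p ^ 2)) : 'F_p :=
  if (lam i).2 == 0 then 1 else - (lam i).1 / (lam i).2.

(* The automorphisms defined by t_i = (t_(i+1), sigma^(e_i), 1, ..., 1); see
   [spineE]. *)
Fixpoint spine (e : 'Z_(p ^ 2) -> 'F_p) (i : 'Z_(p ^ 2)) (w : word) : word :=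
  if w is x :: w' then
    x :: (if x == 0 then spine e (i + 1) w'
          else if x == 1 then sigma_pow (e i) w'
          else w')
  else [::].

Lemma spineE e i :
  spine e i = wreath (fun x => if x == 0 then spine e (i + 1)
                               else if x == 1 then sigma_pow (e i)
                               else id) id.
Proof. by apply/funext => -[//|x w] /=; case: ifP => _ //; case: ifP. Qed.

Lemma spineK e i : cancel (spine e i) (spine (fun j => - e j) i).
Proof.
move=> w; elim: w i => //= x w IH i; congr (_ :: _).
case: ifP => x0; rewrite x0; first exact: IH.
by case: ifP => x1; rewrite x1 //; exact: sigma_powK.
Qed.

Lemma spine_compatible e i : rcons_compatible (spine e i).
Proof.
split=> // v x; elim: v i => [|y v IH] i /=.
  by exists x; case: ifP => // _; case: ifP; rewrite ?sigma_pow0.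
case: ifP => _; first by have [z ->] := IH (i + 1); exists z.
case: ifP => _; last by exists x.
by have [z ->] := (sigma_pow_compatible (e i)).2 v x; exists z.
Qed.

Definition sus_q : 'Z_(p ^ 2) -> word -> word := spine sus_u.
Definition sus_r : 'Z_(p ^ 2) -> word -> word := spine sus_v.

Definition sus_A : word -> word := wreath sigma_pow (fun x => x + 1).

(* The first letters 0, 1, 2 are pairwise distinct only when p > 2. *)
Definition B_restr (x y : 'F_p) : word -> word :=
  if (x, y) == (0, 0) then sus_q 1
  else if (x, y) == (1, 0) then sus_r 1
  else if (x, y) == (2, 1) then sigma
  else id.

Definition sus_B : word -> word :=
  wreath (fun x => wreath (B_restr x) id) id.

Lemma sus_B_trivial x y : sus_B [:: x; y] = [:: x; y].
Proof.
rewrite /sus_B /= /B_restr.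
by case: ifP => // _; case: ifP => // _; case: ifP.
Qed.

Lemma restriction_sus_B x y : restriction sus_B [:: x; y] = B_restr x y.
Proof. by apply/funext => w; rewrite /restriction /= drop0. Qed.

Definition sushchansky : set (word -> word) := generated [set sus_A; sus_B].

Lemma sus_A_tree_aut : tree_aut sus_A.
Proof.
pose Ai := wreath (fun x => sigma_pow (- (x - 1))) (fun x : 'F_p => x - 1).
apply: (@tree_aut_cancel _ _ Ai) => [[|x w]|[|x w]||] //=.
- by rewrite addrK sigma_powK.
- by rewrite subrK -{1}(opprK (x - 1)) sigma_powK.
- by apply: wreath_compatible => x; exact: sigma_pow_compatible.
- by apply: wreath_compatible => x; exact: sigma_pow_compatible.
Qed.

Lemma sus_B_tree_aut : tree_aut sus_B.
Proof.
pose R (x y : 'F_p) (a b c : word -> word) : word -> word :=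
  if (x, y) == (0, 0) then a else if (x, y) == (1, 0) then b
  else if (x, y) == (2, 1) then c else id.
pose Bi : word -> word := wreath (fun x => wreath (fun y =>
  R x y (spine (fun j => - sus_u j) 1) (spine (fun j => - sus_v j) 1)
    (sigma_pow (- 1))) id) id.
have spineNK e i : cancel (spine (fun j => - e j) i) (spine e i).
  have -> : spine e i = spine (fun j => - - e j) i.
    by congr (spine _ i); apply/funext => j; rewrite opprK.
  exact: spineK.
apply: (@tree_aut_cancel _ _ Bi).
- case=> [|x [|y w]] //=; do 2 congr (_ :: _); rewrite /R /B_restr.
  case: ifP => _; first exact: spineK.
  case: ifP => _; first exact: spineK.
  by case: ifP => _ //; rewrite sigma1 sigma_powK.
- case=> [|x [|y w]] //=; do 2 congr (_ :: _); rewrite /R /B_restr.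
  case: ifP => _; first exact: spineNK.
  case: ifP => _; first exact: spineNK.
  by case: ifP => _ //; rewrite sigma1 -{1}(opprK 1) sigma_powK.
- apply: wreath_compatible => x; apply: wreath_compatible => y; rewrite /B_restr.
  do 2 (case: ifP => _; first exact: spine_compatible).
  case: ifP => _; first by rewrite sigma1; exact: sigma_pow_compatible.
  by split=> // v z; exists z.
- apply: wreath_compatible => x; apply: wreath_compatible => y; rewrite /R.
  do 2 (case: ifP => _; first exact: spine_compatible).
  case: ifP => _; first exact: sigma_pow_compatible.
  by split=> // v z; exists z.
Qed.

Lemma sushchansky_tree_aut : sushchansky `<=` @tree_aut _.
Proof.
by apply: generated_tree_aut => g [->|->];
  [exact: sus_A_tree_aut|exact: sus_B_tree_aut].
Qed.

End Sushchansky.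

(* Main.v *)
(* The generator A shifts the first letter and preserves the quantity
   c = x' - x(x-1)/2 of a word x x' w. As B acts trivially on X^2, and its
   nontrivial restrictions sit below 00, 10 and 21, which all have c = 0, the
   action on the words with c <> 0 changes only the first two letters, and w is
   an invariant. On the words with c = 0, powers of A bring the restrictions
   q_1, r_1 and sigma of B below 00, and these three generate a
   level-transitive group. Hence a word x x' w is equivalent to 0 c w if
   c <> 0 and to 0 0 0...0 if c = 0, a description independent of lambda. *)
Require Import Defs.
From mathcomp Require Import all_boot all_order all_algebra.
From mathcomp Require Import boolp classical_sets functions cardinality.
From mathcomp Require Import ring.
From Corelib Require Import RelationClasses.

Import GRing.Theory.

Local Open Scope classical_set_scope.
Local Open Scope card_scope.
Local Open Scope ring_scope.

(** * Equivalence relations preserved by a generated group *)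

Section Equivalences.
Context {X : Type}.
Implicit Types (E : seq X -> seq X -> Prop) (S : set (seq X -> seq X)).

Lemma equivalence_iter E g n w :
  Equivalence E -> (forall v, E v (g v)) -> E w (iter n g w).
Proof.
move=> Eeq Eg; elim: n => [|n IH] /=; first by reflexivity.
by transitivity (iter n g w).
Qed.

(** Symmetry of [E] handles inverses, so an invariant need only be checked on generators. *)
Lemma generated_equivalence S E :
  Equivalence E -> (forall g, S g -> forall w, E w (g w)) ->
  forall g, generated S g -> forall w, E w (g w).
Proof.
move=> Eeq ES g; elim=> {g} [g /ES //|w|g h _ Eg _ Eh w|g h _ Eg gK hK w].
- by reflexivity.
- by transitivity (g w); [exact: Eg|exact: Eh].
- by symmetry; rewrite -{2}(hK w).
Qed.

(** Group elements are bare functions; the inverse needed for symmetry comes from bijectivity of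
    tree automorphisms. *)
Lemma tree_orbit_equivalence S :
  S `<=` @tree_aut X -> Equivalence (fun v => tree_orbit (generated S) v).
Proof.
move=> Saut; split=> [v|v _ [g Gg <-]|v _ _ [g Gg <-] [h Gh <-]].
- by exists id => //; exact: gen_one.
- have [[h gK hK] _ _] := generated_tree_aut Saut Gg.
  by exists h; [exact: gen_inv gK hK|exact: gK].
- by exists (h \o g) => //; exact: gen_mul.
Qed.

End Equivalences.

(** * Level-transitivity of the spines, and representatives of words *)

Section Sushchansky.
Context {p : nat}.
Notation word := (seq 'F_p).
Implicit Types (E : word -> word -> Prop) (w : word) (x k : 'F_p).

Lemma iter_sigma_pow k m x w :
  iter m (sigma_pow k) (x :: w) = x + k *+ m :: w.
Proof.
elim: m => [|m /= ->]; first by rewrite addr0.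
by rewrite sigma_powE mulrSr addrA.
Qed.

Lemma size_sigma_pow k w : size (sigma_pow k w) = size w.
Proof. by case: w => [|x w]; rewrite ?sigma_pow0 ?sigma_powE. Qed.

Lemma size_spine e i w : size (spine e i w) = size w.
Proof.
elim: w i => //= x w IH i; case: ifP => _; first by rewrite IH.
by case: ifP => _; rewrite ?size_sigma_pow.
Qed.

(* Conjugating a spine by [sigma] turns its branch at the letter 1 into an
   action below the letter 0; one of the two exponents there is invertible, so
   [sigma] and both spines of index [i + 1] reappear below 0. *)
Lemma spine_transitive (e f : 'Z_(p ^ 2) -> 'F_p) i E w :
  (forall j, (e j != 0) || (f j != 0)) -> Equivalence E ->
  (forall v, E v (spine e i v)) -> (forall v, E v (spine f i v)) ->
  (forall v, E v (sigma v)) -> E w (nseq (size w) 0).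
Proof.
move=> ef0; elim: w => [|x w IH] /= in i E *; first by move=> *; reflexivity.
move=> Eeq Ee Ef Es.
have Ehead y z v : E (y :: v) (z :: v).
  have := equivalence_iter E (@sigma p) (z - y)%R (y :: v) Eeq Es.
  by rewrite -/(sigma_pow (z - y) (y :: v)) sigma_powE addrC subrK.
transitivity (0 :: w); first exact: Ehead.
have branch g v : (forall w', E w' (spine g i w')) ->
    E (0 :: v) (0 :: sigma_pow (g i) v).
  move=> Eg; transitivity (1 :: v); first exact: Ehead.
  transitivity (1 :: sigma_pow (g i) v); last exact: Ehead.
  exact: (Eg (1 :: v)).
(* The induction hypothesis is applied to [E] seen below the letter 0. *)
pose E0 a b := E (0 :: a) (0 :: b).
have E0eq : Equivalence E0.
  by split=> [a|a b|a b c]; rewrite /E0; [reflexivity|symmetry|transitivity (0 :: b)].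
have E0s g : g i != 0 -> (forall v, E v (spine g i v)) ->
    forall v, E0 v (sigma v).
  move=> g0 Eg [|y v]; first by reflexivity.
  (* Iterating a shift by [g i] as often as the residue of its inverse gives a shift by 1. *)
  have := equivalence_iter E0 (sigma_pow (g i)) ((g i)^-1)%R (y :: v) E0eq
    (fun v => branch g v Eg).
  by rewrite iter_sigma_pow -mulr_natr natr_Zp divff.
apply: (IH (i + 1) E0) => //.
- by move=> v; exact: (Ee (0 :: v)).
- by move=> v; exact: (Ef (0 :: v)).
- by have /orP[/E0s|/E0s] := ef0 i; apply.
Qed.

(** The sum 0 + 1 + ... + (x-1), which [x] applications of A add to the second letter of a word
    starting with 0. *)
Definition bin2 x : 'F_p := x * (x - 1) / 2.

Definition orbit_rep w : word :=
  match w with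
  | [::] => [::]
  | [:: _] => [:: 0]
  | x :: x' :: w' => let c := x' - bin2 x in
      0 :: c :: (if c == 0 then nseq (size w') 0 else w')
  end.

Lemma size_orbit_rep w : size (orbit_rep w) = size w.
Proof. by case: w => [|x [|y w]] //=; case: ifP; rewrite ?size_nseq. Qed.

Hypotheses (p_prime : prime p) (p_gt2 : (2 < p)%N).

Lemma Fp2_neq0 : 2 != 0 :> 'F_p.
Proof. by rewrite -(dvdn_pcharf (pchar_Fp p_prime)) gtnNdvd. Qed.

Lemma bin2_0 : bin2 0 = 0.
Proof. by rewrite /bin2 !mul0r. Qed.

Lemma bin2_1 : bin2 1 = 0.
Proof. by rewrite /bin2 subrr mulr0 mul0r. Qed.

Lemma bin2_2 : bin2 2 = 1.
Proof. by rewrite /bin2; field; exact: Fp2_neq0. Qed.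

Lemma bin2S x : bin2 (x + 1) = bin2 x + x.
Proof. by rewrite /bin2; field; exact: Fp2_neq0. Qed.

(** Lets an edge of the tree be moved to another vertex of the same orbit. *)
Lemma orbit_rep_rcons v w x :
  orbit_rep v = orbit_rep w ->
  exists y, orbit_rep (rcons v x) = orbit_rep (rcons w y).
Proof.
case: v w => [|a [|b v]] [|a' [|b' w]] //=.
  (* The new letter is chosen to keep the value of c. *)
  by move=> _; exists (x - bin2 a + bin2 a'); rewrite addrK.
move: (b - _) (b' - _) => c c' [-> vw]; exists x; rewrite !size_rcons.
case: ifP vw => // _.
  by move=> /(congr1 size); rewrite !size_nseq => ->.
by move=> ->.
Qed.

(** * Orbits as fibres of the representative *)

Section Orbits.
Variable lam : 'Z_(p ^ 2) -> 'F_p * 'F_p.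
Local Notation G := (sushchansky lam).

#[local] Instance sus_equivalence : Equivalence (fun v => tree_orbit G v).
Proof.
by apply: tree_orbit_equivalence => g [->|->];
  [exact: sus_A_tree_aut|exact: sus_B_tree_aut].
Qed.

Lemma orbit_rep_sus g w : G g -> orbit_rep (g w) = orbit_rep w.
Proof.
move=> Gg; symmetry; move: g Gg w.
apply: (generated_equivalence _ (fun v w => orbit_rep v = orbit_rep w)) =>
  [|g [->|->]].
- by split=> [//|//|a b c -> ->].
- case=> [|x [|y w]] //=; first by rewrite sigma_pow0.
  by rewrite sigma_powE /= bin2S opprD addrACA subrr addr0.
- case=> [|x [|y w]] //=; rewrite /B_restr.
  case: ((x, y) =P (0, 0)) => [[-> ->]|_].
    by rewrite bin2_0 subrr eqxx size_spine.
  case: ((x, y) =P (1, 0)) => [[-> ->]|_].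
    by rewrite bin2_1 subrr eqxx size_spine.
  case: ((x, y) =P (2, 1)) => [[-> ->]|_] //.
  by rewrite bin2_2 subrr eqxx sigma1 size_sigma_pow.
Qed.

Lemma tree_orbit_iterA n w : tree_orbit G w (iter n (@sus_A p) w).
Proof.
apply: (equivalence_iter (fun v => tree_orbit G v)) => v.
by exists (@sus_A p) => //; apply: gen_in; left.
Qed.

Lemma tree_orbit_shift x w c :
  tree_orbit G (0 :: c :: w) (x :: c + bin2 x :: w).
Proof.
have <- : iter x (@sus_A p) (0 :: c :: w) = x :: c + bin2 x :: w.
  (* The letter [x] becomes the image of the iteration count, which opens the induction. *)
  rewrite -{2 3}(natr_Zp x); elim: (x : nat) => [|n /= ->].
    by rewrite bin2_0 addr0.
  by rewrite [LHS]/= sigma_powE -natr1 bin2S addrA.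
exact: tree_orbit_iterA.
Qed.

(** Conjugating B by the power [x] of A carries its restriction below [x y] to the word 00. *)
Lemma tree_orbit_restr x y v :
  y = bin2 x -> tree_orbit G (0 :: 0 :: v) (0 :: 0 :: B_restr lam x y v).
Proof.
move=> yx; have shift w : tree_orbit G (0 :: 0 :: w) (x :: y :: w).
  by rewrite yx -[bin2 x]add0r; exact: tree_orbit_shift.
transitivity (x :: y :: v); first exact: shift.
transitivity (x :: y :: B_restr lam x y v); last by symmetry; exact: shift.
by exists (sus_B lam) => //; apply: gen_in; right.
Qed.

Lemma tree_orbit_rep w : tree_orbit G w (orbit_rep w).
Proof.
case: w => [|x [|y w]]; first by reflexivity.
  have iterA n : iter n (@sus_A p) [:: x] = [:: x + n%:R].
    elim: n => [|n /= ->]; first by rewrite addr0.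
    by rewrite /= sigma_pow0 -addrA natr1.
  by have := tree_orbit_iterA (- x)%R [:: x]; rewrite iterA natr_Zp subrr.
rewrite /=; set c := y - bin2 x.
transitivity (0 :: c :: w).
  by symmetry; have := tree_orbit_shift x w c; rewrite /c subrK.
case: eqP => [->|_]; last by reflexivity.
pose E a b := tree_orbit G (0 :: 0 :: a) (0 :: 0 :: b).
apply: (spine_transitive (sus_u lam) (sus_v lam) 1 E).
(* Whether or not the second coordinate vanishes, one of the two exponents is 1. *)
- by move=> j; rewrite /sus_u /sus_v; case: ifP; rewrite ?oner_eq0 ?orbT.
- split=> [a|a b Eab|a b d Eab Ebd]; rewrite /E; first by reflexivity.
    by symmetry.
  by transitivity (0 :: 0 :: b).
- by move=> v; exact: (tree_orbit_restr 0 0 v (esym bin2_0)).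
- by move=> v; exact: (tree_orbit_restr 1 0 v (esym bin2_1)).
- move=> v; have := tree_orbit_restr 2 1 v (esym bin2_2); rewrite /B_restr.
  (* The second letter 1 separates 21 from 00 and 10. *)
  by rewrite !xpair_eqE oner_eq0 !andbF !eqxx.
Qed.

(** The representative is constant on orbits and lies in the orbit of its word. *)
Lemma tree_orbitE w : tree_orbit G w = [set v | orbit_rep v = orbit_rep w].
Proof.
apply/seteqP; split=> [_ [g Gg <-]|v /= vw]; first exact: orbit_rep_sus.
transitivity (orbit_rep w); first exact: tree_orbit_rep.
by rewrite -vw; symmetry; exact: tree_orbit_rep.
Qed.

Lemma tree_orbit_eq v w :
  tree_orbit G v = tree_orbit G w <-> orbit_rep v = orbit_rep w.
Proof.
rewrite !tree_orbitE; split=> [vw|->] //.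
by have : [set u | orbit_rep u = orbit_rep w] v by rewrite -vw.
Qed.

(** * Children in the orbit tree and their number *)

Lemma children_tree_orbit w :
  children G (tree_orbit G w) = range (fun x => tree_orbit G (rcons w x)).
Proof.
apply/seteqP; split=> [_ [n [[v /= vn vw] [v' /= v'n <-] [u [u' [wu v'u' uu']]]]]|].
  have uw : orbit_rep u = orbit_rep w by move: wu; rewrite tree_orbitE.
  have u'v' : orbit_rep u' = orbit_rep v' by move: v'u'; rewrite tree_orbitE.
  have su := congr1 size uw; have su' := congr1 size u'v'.
  have svw : size v = size w.
    by move/tree_orbit_eq : vw => /(congr1 size); rewrite !size_orbit_rep.
  rewrite !size_orbit_rep in su su'; case: uu' => -[x E].
    have [y Ey] := orbit_rep_rcons _ _ x uw.
    by exists y => //; apply/tree_orbit_eq; rewrite -u'v' E.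
  (* Lengths rule out an edge towards the root. *)
  by move: su; rewrite E size_rcons su' v'n -vn svw => /eqP; rewrite gtn_eqF.
move=> _ [x _ <-]; exists (size w); split.
- by exists w.
- by exists (rcons w x); rewrite /= ?size_rcons.
- by exists w, (rcons w x); rewrite !tree_orbitE; split=> //; left; exists x.
Qed.

Lemma descendant_tree_orbit a b v O :
  descendant G (tree_orbit G [:: a, b & v]) O ->
  exists w, O = tree_orbit G [:: a, b & w].
Proof.
elim=> [|O1 O2 _ [w ->]]; first by exists v.
by rewrite children_tree_orbit => -[x _ <-]; exists (rcons w x).
Qed.

(** Here c = 0, and the representative retains only the length of the tail. *)
Lemma children_ray a b w :
  b = bin2 a -> children G (tree_orbit G [:: a, b & w]) #= `I_1.
Proof.
move=> ->; rewrite children_tree_orbit.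
suff -> : range (fun x => tree_orbit G (rcons [:: a, bin2 a & w] x)) =
    [set tree_orbit G (rcons [:: a, bin2 a & w] 0)] by exact: card_set1.
apply/seteqP; split=> [_ [x _ <-]|_ ->]; last by exists 0.
by apply/tree_orbit_eq; rewrite /= subrr eqxx !size_rcons.
Qed.

Lemma card_eq_Fp : [set: 'F_p] #= `I_p.
Proof.
(* The ordinal bound of ['F_p] equals [p] only through [Fp_cast], by primality. *)
have <- : range (@nat_of_ord _ : 'F_p -> nat) = `I_p.
  apply/seteqP; split=> [_ [x _ <-]|n /= np].
    by rewrite /= -[X in (_ < X)%N](Fp_cast p_prime).
  rewrite -(Fp_cast p_prime) in np.
  by exists (Ordinal np).
by rewrite card_eq_sym; apply: inj_card_eq => x y _ _ /val_inj.
Qed.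

(** Here c is nonzero, and the representative retains the last letter. *)
Lemma children_regular a b w :
  b != bin2 a -> children G (tree_orbit G [:: a, b & w]) #= `I_p.
Proof.
rewrite -subr_eq0 => /negPf c0; rewrite children_tree_orbit.
apply: card_eq_trans card_eq_Fp; apply: inj_card_eq => x y _ _.
by move/tree_orbit_eq; rewrite /= c0; move: (b - _) => c [/rcons_inj[]].
Qed.

Lemma card_level_orbits1 : level_orbits G 1 #= `I_1.
Proof.
suff -> : level_orbits G 1 = [set tree_orbit G [:: 0]] by exact: card_set1.
apply/seteqP; split=> [_ [[|x [|]] // _ <-]|_ ->]; last by exists [:: 0].
exact/tree_orbit_eq.
Qed.

Lemma card_level_orbits2 : level_orbits G 2 #= `I_p.
Proof.
have -> : level_orbits G 2 = range (fun x => tree_orbit G [:: 0; x]).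
  apply/seteqP; split=> [_ [[|a [|b []]] // _ <-]|_ [x _ <-]].
    exists (b - bin2 a) => //; apply/tree_orbit_eq.
    by rewrite /= bin2_0 subr0.
  by exists [:: 0; x].
apply: card_eq_trans card_eq_Fp; apply: inj_card_eq => x y _ _.
by move/tree_orbit_eq; rewrite /= bin2_0 !subr0 => -[].
Qed.

End Orbits.

Lemma tree_orbit_sus_indep lam lam' :
  tree_orbit (sushchansky lam) = tree_orbit (sushchansky lam') :> (word -> _).
Proof. by apply/funext => w; rewrite !tree_orbitE. Qed.

End Sushchansky.

Theorem proposition3 (p : nat) (p_prime : prime p) (p_gt2 : (2 < p)%N) :
  (forall lam lam' : 'Z_(p ^ 2) -> 'F_p * 'F_p,
     ordering lam -> ordering lam' ->
     orbit_tree_iso (sushchansky lam) (sushchansky lam'))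
  /\
  (forall lam : 'Z_(p ^ 2) -> 'F_p * 'F_p,
     ordering lam ->
     let G := sushchansky lam in
     let O00 := tree_orbit G [:: 0; 0] in
     [/\ level_orbits G 0 #= `I_1,
         level_orbits G 1 #= `I_1,
         level_orbits G 2 #= `I_p /\
           (forall O1 O2, level_orbits G 1 O1 -> level_orbits G 2 O2 ->
              orbit_adj O1 O2),
         (forall O, descendant G O00 O -> children G O #= `I_1) &
         (forall O2, level_orbits G 2 O2 -> O2 <> O00 ->
            forall O, descendant G O2 O -> children G O #= `I_p)]).
Proof.
split=> [lam lam' _ _|lam _ G O00].
  (* The orbits of both groups coincide as sets of words. *)
  exists id; rewrite (tree_orbit_sus_indep p_prime p_gt2 lam lam').
  split=> //; split=> [O|//|O].
    by rewrite /orbit_vertices /level_orbits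
      (tree_orbit_sus_indep p_prime p_gt2 lam lam').
  rewrite /orbit_vertices /level_orbits
      (tree_orbit_sus_indep p_prime p_gt2 lam lam').
  by exists O.
have orbE := tree_orbitE p_prime p_gt2 lam.
split; [|exact: card_level_orbits1|split; first exact: card_level_orbits2| |].
- suff -> : level_orbits G 0 = [set tree_orbit G [::]] by exact: card_set1.
  apply/seteqP; split=> [_ [[] // _ <-] //|_ ->].
  by exists [::].
- move=> _ _ [[|a [|]] // _ <-] [[|b [|c []]] // _ <-].
  (* Words of length 1 share one representative, so the first orbit contains the parent of [b c]. *)
  by exists [:: b], [:: b; c]; rewrite !orbE; split=> //; left; exists c.
- move=> O /descendant_tree_orbit[] // w ->.
  by apply: children_ray => //; rewrite bin2_0.
move=> _ [[|a [|b []]] // _ <-] ab O /descendant_tree_orbit[] // w ->.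
(* If c were 0, the orbit would be that of 00. *)
apply: children_regular => //; apply/eqP => E; apply: ab.
by apply/tree_orbit_eq => //=; rewrite E bin2_0 !subrr.
Qed.
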